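(* Let $\Bbbk$ be a perfect field, let $\lambda_0,\lambda_1,\ldots,\lambda_{n-1}$ be $n$ distinct elements of $\Bbbk$, let $m_0,\ldots,m_{n-1}$ be positive integers, and let $a_{ij}\in\Bbbk$ for $0\le j\le n-1$, $0\le i\le m_j-1$. Then there exists one and only one polynomial $r\in\Bbbk[x]$ of degree less than $\sum_{i=0}^{n-1}m_i$ such that $$r^{(i)}(\lambda_j)=a_{ij},\qquad 0\le j\le n-1,\ 0\le i\le m_j-1.$$ This polynomial $r$ is explicitly given by $$r=\sum_{j=0}^{n-1}X_j\Lambda_j^{-1}A_j=\sum_{j=0}^{n-1}\sum_{k=0}^{m_j-1}X_j\,(I_{m_j}-\Lambda_j)^k A_j,$$ where $I_{m_j}$ is the $m_j\times m_j$ identity matrix, $X_j$ is the row vector $$X_j=\left[L_j(x),\ \frac{(x-\lambda_j)}{1!}L_j(x),\ \ldots,\ \frac{(x-\lambda_j)^{m_j-1}}{(m_j-1)!}L_j(x)\right],$$ and $A_j$ is the column vector $A_j=[a_{0j},a_{1j},\ldots,a_{m_j-1\,j}]^T$.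
   Context: $r^{(i)}$ denotes the $i$-th (formal) derivative of $r$. For $0\le k\le n-1$, $$L_k(x)=\prod_{\substack{i=0\\ i\ne k}}^{n-1}\frac{(x-\lambda_i)^{m_i}}{(\lambda_k-\lambda_i)^{m_i}}\in\Bbbk[x],$$ and $\Lambda_k=[l_{ij}]_{0\le i,j\le m_k-1}\in\Bbbk^{m_k\times m_k}$ is the lower triangular matrix with $l_{ij}=\binom{i}{j}L_k^{(i-j)}(\lambda_k)$ if $0\le j\le i\le m_k-1$ and $l_{ij}=0$ if $0\le i<j\le m_k-1$.
   Formalization: It is assumed that k! is nonzero in the field for all k < m_j (characteristic 0, or p at least every m_j); otherwise X_j is undefined and the claim fails, e.g. over F_2 with n=1, m_0=3, a=(0,0,1), as r''=0 for every r. *)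

(* Defs.v *)
From mathcomp Require Import all_boot all_order all_algebra all_field.

Set Implicit Arguments.
Unset Strict Implicit.
Unset Printing Implicit Defensive.

Import GRing.Theory.
Local Open Scope ring_scope.

Definition perfect_field (F : fieldType) : Prop :=
  forall p : {poly F}, irreducible_poly p -> separable_poly p.

Section HermiteInterpolation.

Variables (F : fieldType) (n : nat) (lam : 'I_n -> F) (m : 'I_n -> nat).

(* The scalar a i j of the usual notation (i = order of the derivative,
   j = index of the node) is [a j i]: the range of i depends on j. *)
Variable a : forall j : 'I_n, 'I_(m j) -> F.

(* The degree bound is [size r <= _] because [size] is degree + 1; the zero
   polynomial is allowed. *)
Definition hermite_interpolant (r : {poly F}) : Prop :=
  (size r <= \sum_(i < n) m i)%N /\
  forall (j : 'I_n) (i : 'I_(m j)), (r^`(i)).[lam j] = a i.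

Definition hermite_L (k : 'I_n) : {poly F} :=
  \prod_(i < n | i != k)
    ((lam k - lam i) ^- m i *: ('X - (lam i)%:P) ^+ m i).

Definition hermite_Lambda (k : 'I_n) : 'M[F]_(m k) :=
  \matrix_(i < m k, j < m k)
    if (j <= i)%N then 'C(i, j)%:R * ((hermite_L k)^`(i - j)).[lam k] else 0.

(* Since 0^-1 = 0 in MathComp, this is the intended vector only if k! is nonzero
   in F for all k < m j, i.e. in characteristic 0 or p >= m j. *)
Definition hermite_X (j : 'I_n) : 'rV[{poly F}]_(m j) :=
  \row_(k < m j) ((k`!)%:R^-1 *: (('X - (lam j)%:P) ^+ k * hermite_L j)).

Definition hermite_A (j : 'I_n) : 'cV[F]_(m j) := \col_(i < m j) a i.

(* The product of the row X_j of polynomials with a column v of scalars,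
   read as a polynomial rather than as a 1 x 1 matrix. *)
Definition hermite_X_mul (j : 'I_n) (v : 'cV[F]_(m j)) : {poly F} :=
  (hermite_X j *m map_mx polyC v) 0 0.

End HermiteInterpolation.

(* Main.v *)
(* By the Leibniz rule the i-th derivative of ((X - c)^k / k!) q at c is
   binom(i, k) q^(i-k)(c).  Hence the derivatives at lambda_j of X_j v are the
   entries of Lambda_j v, while those of X_l v for l != j vanish up to order
   m_j - 1 because (X - lambda_j)^m_j divides L_l; taking
   v = Lambda_j^-1 A_j gives an interpolant.  Since L_j(lambda_j) = 1, Lambda_j
   is lower unitriangular, so I - Lambda_j is nilpotent and Lambda_j^-1 is a
   finite Neumann series.  The difference of two interpolants is divisible by
   the product of the coprime (X - lambda_j)^m_j, whose degree is too large. *)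
Require Import Defs.
From mathcomp Require Import all_boot all_order all_algebra all_field.

Import GRing.Theory.
Local Open Scope ring_scope.

(** Induction on [i] with [q] general: differentiating [(X - c)^(k+1) q] once leaves two terms of
    the same form. The falling factorial [i ^_ k] is zero for [i < k], so the truncated [i - k] does
    no harm. *)
Lemma horner_derivn_XsubC_expM {R : comNzRingType} (c : R) (i k : nat)
    (q : {poly R}) :
  ((('X - c%:P) ^+ k * q)^`(i)).[c] = (q^`(i - k)).[c] *+ i ^_ k.
Proof.
elim: i k q => [|i IHi] [|k] q.
- by rewrite !mul1r.
- by rewrite sub0n ffact0n !derivn0 hornerM horner_exp hornerXsubC subrr
             expr0n mul0r.
- by rewrite mul1r subn0.
rewrite derivSn derivM deriv_exp derivXsubC mul1r /= mulrnAl derivnD derivnMn.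
rewrite hornerD hornerMn !IHi subSS -mulrnA ffactSS.
case: (ltnP k i) => [lt_ki|le_ik].
  (* Both terms carry the same derivative of [q], and [i ^_ k * (k + 1 + (i - k)) = (i + 1) * i ^_
     k]. *)
  rewrite -derivSn subnSK // -mulrnDr ffactnSr -mulnDr addSn subnKC 1?ltnW //.
  by rewrite mulnC.
rewrite [i ^_ k.+1]ffact_small // addr0.
have [->|ne_ik] := eqVneq i k; first by rewrite mulnC.
by rewrite ffact_small ?muln0 // ltn_neqAle ne_ik.
Qed.

(* The multiplicity is raised one step at a time: if p = (X - c)^k q, then
   p^`(k).[c] = k! q.[c]. *)
Lemma dvdp_XsubC_exp {F : fieldType} (c : F) (m : nat) (p : {poly F}) :
    (forall k, (k < m)%N -> (k`!)%:R != 0 :> F) ->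
    (forall k, (k < m)%N -> (p^`(k)).[c] = 0) ->
  ('X - c%:P) ^+ m %| p.
Proof.
elim: m => [|m IHm] fact_neq0 dp0; first exact: dvd1p.
have /dvdpP[q def_p] : ('X - c%:P) ^+ m %| p.
  by apply: IHm => k lt_km; [apply: fact_neq0 | apply: dp0]; apply: ltnW.
rewrite def_p exprSr [q * _]mulrC dvdp_mul2l ?expf_neq0 ?polyXsubC_eq0 //.
rewrite dvdp_XsubCl; apply/rootP/(mulIf (fact_neq0 m (ltnSn m))).
by rewrite mul0r mulr_natr -(dp0 m (ltnSn m)) def_p mulrC
           horner_derivn_XsubC_expM subnn ffactnn.
Qed.

(** Gauss's lemma along a duplicate-free enumeration: [lam j] is not a root of the product of the
    later factors, so the factor at [j] is coprime to it. *)
Lemma dvdp_prod_XsubC_exp {F : fieldType} {n : nat} (lam : 'I_n -> F)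
    (m : 'I_n -> nat) (p : {poly F}) :
    injective lam -> (forall j, ('X - (lam j)%:P) ^+ m j %| p) ->
  \prod_(j < n) ('X - (lam j)%:P) ^+ m j %| p.
Proof.
move=> lam_inj dvd_p; rewrite -big_enum /=.
elim: (enum _) (enum_uniq 'I_n) => [|j s IHs] /= => [_|/andP[s'j /IHs dvd_s]].
  by rewrite big_nil dvd1p.
rewrite big_cons Gauss_dvdp ?dvd_p //.
apply: coprimep_expl; rewrite coprimep_sym coprimep_XsubC.
rewrite /root horner_prod prodf_seq_neq0; apply/allP => i s_i /=.
rewrite horner_exp hornerXsubC expf_neq0 // subr_eq0 (inj_eq lam_inj).
by apply: contraNneq s'j => ->.
Qed.

Lemma size_prod_XsubC_exp {F : fieldType} {I : finType} (P : pred I)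
    (lam : I -> F) (m : I -> nat) :
  size (\prod_(i | P i) ('X - (lam i)%:P) ^+ m i) = (\sum_(i | P i) m i).+1.
Proof.
rewrite size_prod => [|i _]; last by rewrite expf_neq0 ?polyXsubC_eq0.
under eq_bigr do rewrite size_exp_XsubC -addn1.
by rewrite big_split /= sum1_card -addSn addnK.
Qed.

Section Unitriangular.

Context {R : comUnitRingType} {n : nat} {A : 'M[R]_n}.
Hypotheses (A_trig : is_trig_mx A) (A_diag : forall i, A i i = 1).

Lemma unitriangular_unitmx : A \in unitmx.
Proof. by rewrite unitmxE det_trig // big1 ?unitr1. Qed.

(** Each factor of the strictly lower triangular [1 - A] pushes the support one diagonal further
    down. *)
Lemma unitriangular_expr_eq0 (k : nat) (i j : 'I_n) :
  (i < j + k)%N -> ((1%:M - A) ^+ k) i j = 0.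
Proof.
elim: k i j => [|k IHk] i j lt_ijk.
  by rewrite expr0 mxE -val_eqE /= ltn_eqF // -[X in (_ < X)%N]addn0.
rewrite exprS mxE big1 // => l _; have [le_il|lt_li] := leqP i l.
  rewrite !mxE; have [<-|ne_il] := eqVneq i l.
    by rewrite A_diag subrr mul0r.
  rewrite (is_trig_mxP A_trig) ?subrr ?mul0r //.
  by rewrite ltn_neqAle val_eqE ne_il.
by rewrite IHk ?mulr0 // -ltnS -addnS (leq_trans _ lt_ijk).
Qed.

Lemma unitriangular_invmx : invmx A = \sum_(k < n) (1%:M - A) ^+ k.
Proof.
have powN0 : (1%:M - A) ^+ n = 0.
  by apply/matrixP => i j; rewrite mxE unitriangular_expr_eq0 // ltn_addl.
have negA : 1%:M - A - 1%:M = - A by rewrite addrAC subrr sub0r.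
have AsumE : A *m (\sum_(k < n) (1%:M - A) ^+ k) = 1%:M.
  (* Geometric sum for [N = 1 - A], with [N - 1 = - A] and [N ^ n = 0]. *)
  have: (1%:M - A) ^+ n - 1 = (1%:M - A - 1%:M) *m _ := subrX1 _ n.
  by rewrite powN0 sub0r negA mulNmx => /oppr_inj.
by rewrite -[RHS](mulKmx unitriangular_unitmx) AsumE mulmx1.
Qed.

End Unitriangular.

Section HermiteInterpolation.

Context {F : fieldType} {n : nat} (lam : 'I_n -> F) (m : 'I_n -> nat).
Hypothesis lam_inj : injective lam.
(** Characteristic 0 or at least every [m j]. In characteristic p the p-th formal derivative is
    identically zero, so a nonzero value prescribed at order p could not be attained. *)
Hypothesis fact_neq0 : forall (j : 'I_n) (k : 'I_(m j)), (k`!)%:R != 0 :> F.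

Local Notation L := (hermite_L lam m).
Local Notation Lambda := (hermite_Lambda lam m).

Lemma hermite_LE (k : 'I_n) :
  L k = \prod_(i < n | i != k) (lam k - lam i) ^- m i
          *: \prod_(i < n | i != k) ('X - (lam i)%:P) ^+ m i.
Proof. exact: scaler_prod. Qed.

Lemma horner_hermite_L (k : 'I_n) : (L k).[lam k] = 1.
Proof.
rewrite horner_prod big1 // => i ne_ik.
rewrite hornerZ horner_exp hornerXsubC mulVf // expf_neq0 // subr_eq0.
by rewrite (inj_eq lam_inj) eq_sym.
Qed.

Lemma size_hermite_L (k : 'I_n) :
  (size (L k) <= (\sum_(i < n | i != k) m i).+1)%N.
Proof.
rewrite hermite_LE (leq_trans (size_scale_leq _ _)) // size_prod_XsubC_exp.
exact: leqnn.
Qed.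

Lemma dvdp_hermite_L (j k : 'I_n) :
  j != k -> ('X - (lam j)%:P) ^+ m j %| L k.
Proof.
move=> ne_jk; rewrite /hermite_L (bigD1 j) //= -scalerAl scalerAr.
exact: dvdp_mulr.
Qed.

Lemma hermite_Lambda_trig (j : 'I_n) : is_trig_mx (Lambda j).
Proof.
by apply/is_trig_mxP => i k lt_ik; rewrite mxE leqNgt lt_ik.
Qed.

Lemma hermite_Lambda_diag (j : 'I_n) (i : 'I_(m j)) : Lambda j i i = 1.
Proof.
by rewrite mxE leqnn subnn binn derivn0 horner_hermite_L mulr1.
Qed.

Lemma hermite_X_mulE (j : 'I_n) (v : 'cV[F]_(m j)) :
  hermite_X_mul lam v
    = (\sum_k (v k 0 / (k`!)%:R) *: ('X - (lam j)%:P) ^+ k) * L j.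
Proof.
rewrite /hermite_X_mul mxE mulr_suml; apply: eq_bigr => k _.
by rewrite !mxE mulrC mul_polyC scalerA -scalerAl.
Qed.

Lemma size_hermite_X_mul (j : 'I_n) (v : 'cV[F]_(m j)) :
  (size (hermite_X_mul lam v) <= \sum_(i < n) m i)%N.
Proof.
rewrite hermite_X_mulE (leq_trans (size_polyMleq _ _)) // (bigD1 j) //=.
(* The predecessor in the size of a product absorbs the successor in the size of [L j]. *)
rewrite -subn1 leq_subLR add1n -addnS leq_add ?size_hermite_L //.
apply: (leq_trans (size_sum _ _ _)); apply/bigmax_leqP => k _.
by rewrite (leq_trans (size_scale_leq _ _)) ?size_exp_XsubC.
Qed.

Lemma horner_derivn_hermite_X_mul (j : 'I_n) (v : 'cV[F]_(m j)) (i : 'I_(m j)) :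
  ((hermite_X_mul lam v)^`(i)).[lam j] = (Lambda j *m v) i 0.
Proof.
rewrite hermite_X_mulE mulr_suml raddf_sum horner_sum mxE.
apply: eq_bigr => k _; rewrite -scalerAl /= derivnZ hornerZ.
(* Writing [i ^_ k] as ['C(i, k) * k!] lets the factorial cancel the [1 / k!] of [X_j]. *)
rewrite horner_derivn_XsubC_expM -bin_ffact mxE.
case: leqP => [_|lt_ik]; last by rewrite bin_small // mul0n mulr0n mulr0 mul0r.
rewrite mulnC mulrnAr -mulr_natl natrM -mulrA mulrA mulrCA.
by rewrite -[k`!%:R * _ * _]mulrA mulrA divfK ?fact_neq0 // mulrC.
Qed.

Lemma horner_derivn_hermite_X_mul_neq (j l : 'I_n) (v : 'cV[F]_(m j))
    (i : 'I_(m l)) :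
  l != j -> ((hermite_X_mul lam v)^`(i)).[lam l] = 0.
Proof.
move=> /dvdp_hermite_L/dvdpP[q defL]; rewrite hermite_X_mulE defL mulrA mulrC.
by rewrite horner_derivn_XsubC_expM ffact_small.
Qed.

Lemma hermite_interpolant_uniq (a : forall j : 'I_n, 'I_(m j) -> F)
    (p q : {poly F}) :
  hermite_interpolant lam a p -> hermite_interpolant lam a q -> p = q.
Proof.
move=> [size_p p_a] [size_q q_a]; apply/eqP; rewrite -subr_eq0.
have: \prod_(j < n) ('X - (lam j)%:P) ^+ m j %| p - q.
  apply: dvdp_prod_XsubC_exp => // j; apply: dvdp_XsubC_exp => k lt_km.
    exact: (fact_neq0 j (Ordinal lt_km)).
  rewrite derivnB hornerD hornerN (p_a j (Ordinal lt_km)).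
  by rewrite (q_a j (Ordinal lt_km)) subrr.
(* If [p - q] were nonzero, its size would be at least the sum of the [m j] plus one. *)
apply: contraTT => /dvdp_leq le_size; apply: contraL (leqnn (\sum_(j < n) m j)).
move=> /le_size; rewrite size_prod_XsubC_exp -ltnNge => /leq_trans; apply.
by rewrite (leq_trans (size_polyD _ _)) // size_polyN geq_max size_p.
Qed.

Lemma hermite_interpolant_sum (a : forall j : 'I_n, 'I_(m j) -> F) :
  hermite_interpolant lam a
    (\sum_(j < n) hermite_X_mul lam (invmx (Lambda j) *m hermite_A a j)).
Proof.
split=> [|l i].
  by apply: (leq_trans (size_sum _ _ _)); apply/bigmax_leqP => j _;
     apply: size_hermite_X_mul.
rewrite raddf_sum horner_sum (bigD1 l) //= big1 => [|j ne_jl].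
  rewrite horner_derivn_hermite_X_mul mulKVmx ?mxE ?addr0 //.
  apply: unitriangular_unitmx (hermite_Lambda_trig l) _.
  exact: hermite_Lambda_diag.
by rewrite horner_derivn_hermite_X_mul_neq // eq_sym.
Qed.

End HermiteInterpolation.

Theorem theorem2p3 (F : fieldType) (n : nat) (lam : 'I_n -> F)
    (m : 'I_n -> nat) (a : forall j : 'I_n, 'I_(m j) -> F)
    (F_perfect : perfect_field F)
    (lam_inj : injective lam)
    (m_gt0 : forall j : 'I_n, (0 < m j)%N)
    (fact_neq0 : forall (j : 'I_n) (k : 'I_(m j)), (k`!)%:R != 0 :> F) :
  (forall j : 'I_n, hermite_Lambda lam m j \in unitmx) /\
  exists r : {poly F},
    [/\ unique (hermite_interpolant lam a) r,
        r = \sum_(j < n)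
              hermite_X_mul lam
                (invmx (hermite_Lambda lam m j) *m hermite_A a j)
      & r = \sum_(j < n) \sum_(k < m j)
              hermite_X_mul lam
                ((1%:M - hermite_Lambda lam m j) ^+ k *m hermite_A a j)].
Proof.
have Lambda_diag j := hermite_Lambda_diag lam m lam_inj j.
have Lambda_unit j : hermite_Lambda lam m j \in unitmx.
  exact: unitriangular_unitmx (hermite_Lambda_trig lam m j) (Lambda_diag j).
split=> //.
exists (\sum_(j < n) hermite_X_mul lam
          (invmx (hermite_Lambda lam m j) *m hermite_A a j)).
split=> //.
  have r_a := hermite_interpolant_sum lam m lam_inj fact_neq0 a.
  by split=> // s; apply: hermite_interpolant_uniq.
apply: eq_bigr => j _.
(* The Neumann series is expanded by linearity of [X_j v] in [v]. *)
rewrite (unitriangular_invmx (hermite_Lambda_trig lam m j) (Lambda_diag j)).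
by rewrite mulmx_suml /hermite_X_mul raddf_sum mulmx_sumr summxE.
Qed.
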